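(* Let $N>2$, let $x_1<x_2<\dots<x_N$, $I=[x_1,x_N]$, and suppose that a data set $\{(x_i,y_i): i=1,\dots,N\}$ is prescribed, where $y_i\ge p_i:=p(x_i)$ for all $i=1,\dots,N$ and $p$ is a piecewise linear function on $I$ with joints at the knots $x_i$. Let $d_i$ be the derivative values at the knots $x_i$, and let $f^\alpha$ be the rational cubic spline fractal interpolation function (defined in the context) with scaling factors $\alpha_i$ and positive shape parameters $r_i,t_i$, $i=1,\dots,N-1$. Then a sufficient condition for $f^\alpha$ to lie above $p$ (that is, $f^\alpha(x)\ge p(x)$ for all $x\in I$) is that the parameters satisfy the following inequalities: (i) $|\alpha_i|<a_i$ for $i=1,\dots,N-1$, and $|\alpha|_\infty\le\min\Big\{\dfrac{y_i-p_i}{y_i-p_i+M}: i=1,\dots,N\Big\}$; (ii) $r_i(2y_i-p_{i+1}-p_i+h_id_i+2K)+t_i(y_i-p_i+K)\ge0$ for $i=1,\dots,N-1$; (iii) $r_i(y_{i+1}-p_{i+1}+K)+t_i(2y_{i+1}-p_{i+1}-p_i-h_id_{i+1}+2K)\ge0$ for $i=1,\dots,N-1$; where $$M=|y|_\infty+\max\{|y_1|,|y_N|\}+\frac14\big(h|d|_\infty+|I|\max\{|d_1|,|d_N|\}\big),\qquad K=\frac{|\alpha|_\infty}{|\alpha|_\infty-1}M.$$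
   Context: Notation: $h_i=x_{i+1}-x_i$, $h=\max_{1\le i\le N-1}h_i$, $|I|=x_N-x_1$, $a_i=h_i/|I|$, $|y|_\infty=\max_{1\le i\le N}|y_i|$, $|d|_\infty=\max_{1\le i\le N}|d_i|$, $|\alpha|_\infty=\max_{1\le i\le N-1}|\alpha_i|$. The piecewise linear function $p$ is given on $[x_i,x_{i+1}]$ by $p(x)=p_i(1-\varphi)+p_{i+1}\varphi$, $\varphi=\frac{x-x_i}{h_i}$. Let $L_i:I\to[x_i,x_{i+1}]$ be the affine map with $L_i(x_1)=x_i$, $L_i(x_N)=x_{i+1}$. Given real $\alpha_i$ with $|\alpha_i|<a_i$ and positive shape parameters $r_i,t_i$ $(i=1,\dots,N-1)$, the rational cubic spline fractal interpolation function (FIF) $f^\alpha$ is the unique continuous function on $I$ with $$f^\alpha(L_i(x))=\alpha_if^\alpha(x)+\frac{P_i(x)}{Q_i(x)},\quad x\in I,\ i=1,\dots,N-1,$$ where, with $\theta=\frac{x-x_1}{x_N-x_1}$, $$\begin{aligned}P_i(x)=\;&(y_i-\alpha_iy_1)r_i(1-\theta)^3+(y_{i+1}-\alpha_iy_N)t_i\theta^3\\&+\big\{(2r_i+t_i)y_i+r_ih_id_i-\alpha_i[(2r_i+t_i)y_1+r_i(x_N-x_1)d_1]\big\}\theta(1-\theta)^2\\&+\big\{(r_i+2t_i)y_{i+1}-t_ih_id_{i+1}-\alpha_i[(r_i+2t_i)y_N-t_i(x_N-x_1)d_N]\big\}\theta^2(1-\theta),\\Q_i(x)=\;&(1-\theta)r_i+\theta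 t_i.\end{aligned}$$ It is $\mathcal{C}^1$ and satisfies $f^\alpha(x_i)=y_i$. *)

(* Defs.v *)
From mathcomp Require Import all_boot all_order all_algebra.
From mathcomp Require Import all_classical all_reals all_analysis.

Set Implicit Arguments.
Unset Strict Implicit.
Unset Printing Implicit Defensive.

Import Order.TTheory GRing.Theory Num.Theory.
Import numFieldNormedType.Exports.

Local Open Scope classical_set_scope.
Local Open Scope ring_scope.

(* Families indexed by 1, ..., n are functions on nat, of which only the      *)
(* values at 1, ..., n are used.                                              *)

(* max and min of F 1, ..., F n, for 0 < n; taking F 1 as the initial value   *)
(* does not change them.                                                      *)
Definition fam_max (R : realType) (n : nat) (F : nat -> R) : R :=
  \big[Num.max/F 1%N]_(1 <= i < n.+1) F i.

Definition fam_min (R : realType) (n : nat) (F : nat -> R) : R :=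
  \big[Num.min/F 1%N]_(1 <= i < n.+1) F i.

Definition fam_norm (R : realType) (n : nat) (F : nat -> R) : R :=
  fam_max n (fun i => `|F i|).

Definition knot_step (R : realType) (x : nat -> R) (i : nat) : R :=
  x i.+1 - x i.

Definition mesh (R : realType) (N : nat) (x : nat -> R) : R :=
  fam_max N.-1 (knot_step x).

Definition ilen (R : realType) (N : nat) (x : nat -> R) : R := x N - x 1%N.

Definition step_ratio (R : realType) (N : nat) (x : nat -> R) (i : nat) : R :=
  knot_step x i / ilen N x.

Definition piecewise_linear (R : realType) (N : nat) (x : nat -> R)
    (p : R -> R) : Prop :=
  forall (i : nat) (u : R), (1 <= i < N)%N -> u \in `[x i, x i.+1] ->
    let phi := (u - x i) / knot_step x i in
    p u = p (x i) * (1 - phi) + p (x i.+1) * phi.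

Definition theta (R : realType) (N : nat) (x : nat -> R) (u : R) : R :=
  (u - x 1%N) / (x N - x 1%N).

(* The affine map sending x_1 to x_i and x_N to x_{i+1}. *)
Definition Lmap (R : realType) (N : nat) (x : nat -> R) (i : nat) (u : R) : R :=
  x i + knot_step x i * theta N x u.

Definition Pnum (R : realType) (N : nat) (x y d alpha r t : nat -> R)
    (i : nat) (u : R) : R :=
  let th := theta N x u in
  (y i - alpha i * y 1%N) * r i * (1 - th) ^+ 3
  + (y i.+1 - alpha i * y N) * t i * th ^+ 3
  + ((2 * r i + t i) * y i + r i * knot_step x i * d i
     - alpha i * ((2 * r i + t i) * y 1%N + r i * (x N - x 1%N) * d 1%N))
    * (th * (1 - th) ^+ 2)
  + ((r i + 2 * t i) * y i.+1 - t i * knot_step x i * d i.+1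
     - alpha i * ((r i + 2 * t i) * y N - t i * (x N - x 1%N) * d N))
    * (th ^+ 2 * (1 - th)).

Definition Qden (R : realType) (N : nat) (x r t : nat -> R)
    (i : nat) (u : R) : R :=
  (1 - theta N x u) * r i + theta N x u * t i.

(* f is the rational cubic spline FIF: when |alpha_i| < step_ratio N x i and  *)
(* r_i, t_i > 0, these conditions determine f on [x_1, x_N]; values outside   *)
(* this interval are irrelevant.                                              *)
Definition is_rational_cubic_fif (R : realType) (N : nat)
    (x y d alpha r t : nat -> R) (f : R -> R) : Prop :=
  {within `[x 1%N, x N], continuous f} /\
  forall (i : nat) (u : R), (1 <= i < N)%N -> u \in `[x 1%N, x N] ->
    f (Lmap N x i u) =
      alpha i * f u + Pnum N x y d alpha r t i u / Qden N x r t i u.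

Definition Mconst (R : realType) (N : nat) (x y d : nat -> R) : R :=
  fam_norm N y + Num.max `|y 1%N| `|y N|
  + 1 / 4 * (mesh N x * fam_norm N d
             + ilen N x * Num.max `|d 1%N| `|d N|).

Definition Kconst (R : realType) (N : nat) (x y d alpha : nat -> R) : R :=
  fam_norm N.-1 alpha / (fam_norm N.-1 alpha - 1) * Mconst N x y d.

(* Main.v *)
(* On every piece, f (L_i u) = C + alpha_i (f u - B), where C and B are the
   classical (alpha = 0) rational cubics with the data of the piece and with the
   data of the whole interval. In each, the coefficients of the end values are
   nonnegative with sum 1 and the slopes enter with total weight at most
   theta (1 - theta) <= 1/4, so M bounds |C| + |B|. Evaluating the functional
   equation where |f| is maximal gives |f| + |B| <= M / (1 - a) with
   a = |alpha|_oo < 1, whence f >= C - a M / (1 - a) = C + K. Finally C + K - p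
   has a positive denominator and a cubic numerator whose Bernstein-type
   coefficients are nonnegative by (i), (ii) and (iii). *)
Require Import Defs.
From mathcomp Require Import all_boot all_order all_algebra.
From mathcomp Require Import all_classical all_reals all_analysis.
From mathcomp Require Import ring lra zify.

Set Implicit Arguments.
Unset Strict Implicit.
Unset Printing Implicit Defensive.

Import Order.TTheory GRing.Theory Num.Theory.
Import numFieldNormedType.Exports.

Local Open Scope classical_set_scope.
Local Open Scope ring_scope.

(** * Extrema of finite families *)

Section Families.
Variables (R : realType) (n : nat) (F : nat -> R).

Lemma fam_max_ge i : (1 <= i <= n)%N -> F i <= fam_max n F.
Proof.
by move=> hi; apply: le_bigmax_seq; rewrite // mem_index_iota ltnS.
Qed.

Lemma fam_min_le i : (1 <= i <= n)%N -> fam_min n F <= F i.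
Proof.
by move=> hi; apply: ge_bigmin_seq; rewrite // mem_index_iota ltnS.
Qed.

Lemma fam_max_lt (c : R) : (0 < n)%N ->
  (forall i, (1 <= i <= n)%N -> F i < c) -> fam_max n F < c.
Proof.
move=> n0 h; rewrite /fam_max big_seq; apply: bigmax_lt; first exact: h.
by move=> i; rewrite mem_index_iota ltnS; exact: h.
Qed.

End Families.

Lemma fam_norm_ge (R : realType) n (F : nat -> R) i :
  (1 <= i <= n)%N -> `|F i| <= fam_norm n F.
Proof. exact: (@fam_max_ge _ _ (fun i => `|F i|)). Qed.

(** * Bounds for a single rational cubic *)

Section RationalCubic.
Variable R : realType.
Implicit Types r t a b e c s : R.

Definition rcubic_den r t s := (1 - s) * r + s * t.

(* [e] and [c] are the end derivatives multiplied by the interval length. *)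
Definition rcubic_num r t a b e c s :=
  a * r * (1 - s) ^+ 3 + b * t * s ^+ 3
  + ((2 * r + t) * a + r * e) * (s * (1 - s) ^+ 2)
  + ((r + 2 * t) * b - t * c) * (s ^+ 2 * (1 - s)).

Lemma rcubic_den_gt0 r t s :
  0 < r -> 0 < t -> 0 <= s <= 1 -> 0 < rcubic_den r t s.
Proof. by move=> r0 t0 /andP[s0 s1]; rewrite /rcubic_den; nra. Qed.

Lemma bernstein3_ge0 (c0 c1 c2 c3 s : R) : 0 <= s <= 1 ->
  0 <= c0 -> 0 <= c1 -> 0 <= c2 -> 0 <= c3 ->
  0 <= c0 * (1 - s) ^+ 3 + c3 * s ^+ 3
       + c1 * (s * (1 - s) ^+ 2) + c2 * (s ^+ 2 * (1 - s)).
Proof.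
move=> /andP[s0 s1] *; have s1' : 0 <= 1 - s by rewrite subr_ge0.
by rewrite !addr_ge0 ?mulr_ge0 ?exprn_ge0.
Qed.

(** The slopes enter with weights [r * s * (1 - s) ^+ 2] and [t * s ^+ 2 * (1 - s)], whose sum is
    [s * (1 - s)] times the denominator. Since 1/4 = s (1 - s) + (1/2 - s)^2, the gap between the
    two sides is a nonnegative Bernstein-type cubic plus a square term. *)
Lemma rcubic_num_le r t a b e c s (Y E : R) :
  0 < r -> 0 < t -> 0 <= s <= 1 ->
  a <= Y -> b <= Y -> e <= E -> - c <= E -> 0 <= E ->
  rcubic_num r t a b e c s <= (Y + 1 / 4 * E) * rcubic_den r t s.
Proof.
move=> r0 t0 hs aY bY eE cE E0; rewrite -subr_ge0.
have -> : (Y + 1 / 4 * E) * rcubic_den r t s - rcubic_num r t a b e c s =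
  ((Y - a) * r) * (1 - s) ^+ 3 + ((Y - b) * t) * s ^+ 3
  + ((Y - a) * (2 * r + t) + r * (E - e)) * (s * (1 - s) ^+ 2)
  + ((Y - b) * (r + 2 * t) + t * (E + c)) * (s ^+ 2 * (1 - s))
  + E * rcubic_den r t s * (1 / 2 - s) ^+ 2.
  by rewrite /rcubic_num /rcubic_den; field.
have den0 := ltW (rcubic_den_gt0 r0 t0 hs).
apply: addr_ge0; last by rewrite mulr_ge0 ?sqr_ge0 ?mulr_ge0.
by apply: bernstein3_ge0; rewrite // ?addr_ge0 ?mulr_ge0 //; lra.
Qed.

Lemma norm_rcubic_le r t a b e c s (Y E : R) :
  0 < r -> 0 < t -> 0 <= s <= 1 ->
  `|a| <= Y -> `|b| <= Y -> `|e| <= E -> `|c| <= E ->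
  `|rcubic_num r t a b e c s / rcubic_den r t s| <= Y + 1 / 4 * E.
Proof.
move=> r0 t0 hs aY bY eE cE; have E0 := le_trans (normr_ge0 _) eE.
have den0 := rcubic_den_gt0 r0 t0 hs.
move: aY bY eE cE; rewrite !ler_norml.
move=> /andP[a1 a2] /andP[b1 b2] /andP[e1 e2] /andP[c1 c2].
rewrite ler_pdivlMr // ler_pdivrMr //; apply/andP; split; last first.
  by apply: rcubic_num_le => //; lra.
(* The numerator is linear in the data, so the lower bound is the upper bound for the negated
   data. *)
rewrite mulNr lerNl.
have -> : - rcubic_num r t a b e c s = rcubic_num r t (- a) (- b) (- e) (- c) s.
  by rewrite /rcubic_num; ring.
by apply: rcubic_num_le => //; lra.
Qed.

(* The nonnegativity hypotheses are the Bernstein-type coefficients of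
   [rcubic_num + (k - line) * rcubic_den], the line written in degree 3. *)
Lemma rcubic_ge_line r t a b e c s (k u v : R) :
  0 < r -> 0 < t -> 0 <= s <= 1 ->
  0 <= a - u + k -> 0 <= b - v + k ->
  0 <= r * (2 * a - v - u + e + 2 * k) + t * (a - u + k) ->
  0 <= r * (b - v + k) + t * (2 * b - v - u - c + 2 * k) ->
  u * (1 - s) + v * s <= rcubic_num r t a b e c s / rcubic_den r t s + k.
Proof.
move=> r0 t0 hs ha hb hac hbc; have den0 := rcubic_den_gt0 r0 t0 hs.
rewrite -lerBlDr ler_pdivlMr // -subr_ge0.
have -> : rcubic_num r t a b e c s
    - (u * (1 - s) + v * s - k) * rcubic_den r t s =
  (r * (a - u + k)) * (1 - s) ^+ 3 + (t * (b - v + k)) * s ^+ 3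
  + (r * (2 * a - v - u + e + 2 * k) + t * (a - u + k)) * (s * (1 - s) ^+ 2)
  + (r * (b - v + k) + t * (2 * b - v - u - c + 2 * k)) * (s ^+ 2 * (1 - s)).
  by rewrite /rcubic_num /rcubic_den; ring.
by apply: bernstein3_ge0; rewrite // mulr_ge0 // ltW.
Qed.

(** Both cubics carry the shape parameters of piece [i], so [Qden] is their common denominator. *)
Lemma PnumE N (x y d alpha r t : nat -> R) i u :
  Pnum N x y d alpha r t i u =
  rcubic_num (r i) (t i) (y i) (y i.+1)
    (knot_step x i * d i) (knot_step x i * d i.+1) (theta N x u)
  - alpha i * rcubic_num (r i) (t i) (y 1%N) (y N)
    (ilen N x * d 1%N) (ilen N x * d N) (theta N x u).
Proof. by rewrite /Pnum /rcubic_num /ilen; ring. Qed.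

End RationalCubic.

(** * Knots, pieces and the maps [Lmap] *)

Section Knots.
Variables (R : realType) (N : nat) (x : nat -> R).
Hypothesis hx : forall i : nat, (1 <= i < N)%N -> x i < x i.+1.

Lemma knots_le i j : (1 <= i)%N -> (i <= j <= N)%N -> x i <= x j.
Proof.
move=> i1; elim: j => [|j IH]; first by lia.
rewrite leq_eqVlt => /andP[/orP[/eqP-> //|ij] jN].
by apply: (le_trans (IH _)); [lia | apply/ltW/hx; lia].
Qed.

Lemma ilen_gt0 : (1 < N)%N -> 0 < ilen N x.
Proof.
move=> N1; rewrite subr_gt0; apply: (lt_le_trans (hx _)); first by lia.
by apply: knots_le; lia.
Qed.

Lemma knot_step_gt0 i : (1 <= i < N)%N -> 0 < knot_step x i.
Proof. by move=> /hx; rewrite subr_gt0. Qed.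

Lemma step_ratio_le1 i : (1 <= i < N)%N -> step_ratio N x i <= 1.
Proof.
move=> hi; rewrite ler_pdivrMr ?mul1r; last by apply: ilen_gt0; lia.
by apply: lerB; apply: knots_le; lia.
Qed.

Lemma theta_itv u : u \in `[x 1%N, x N] -> 0 <= theta N x u <= 1.
Proof.
rewrite in_itv /= => /andP[u1 uN].
have [xN|xN] := ltP (x 1%N) (x N).
  by rewrite divr_ge0 ?ler_pdivrMr ?mul1r ?subr_ge0 ?subr_gt0 ?lerB // ltW.
(* The interval contains [u], so it is a single point, and division by 0 makes [theta] equal to
   0. *)
by rewrite /theta (_ : x N - x 1%N = 0) ?invr0 ?mulr0 ?lexx ?ler01 //; lra.
Qed.

Lemma piece_of_point v : (1 < N)%N -> v \in `[x 1%N, x N] ->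
  exists2 i, (1 <= i < N)%N & v \in `[x i, x i.+1].
Proof.
move=> N1; rewrite in_itv /= => /andP[v1].
elim: (N) N1 (leqnn N) => [//|n IH n1 nN vn].
have [vlt|xv] := leP v (x n); last first.
  by exists n; [lia | rewrite in_itv /= (ltW xv)].
have [n2|n2] := ltnP 1 n.
  by have [|i hi vi] := IH n2 _ vlt; [lia | exists i => //; lia].
by exists 1%N; [lia | rewrite in_itv /= v1 (_ : 2 = n.+1)%N //; lia].
Qed.

(** This lets the functional equation be read at any prescribed point; [u] is the preimage under the
    inverse affine map. *)
Lemma Lmap_onto v : (1 < N)%N -> v \in `[x 1%N, x N] ->
  exists i u, [/\ (1 <= i < N)%N, u \in `[x 1%N, x N],
    v \in `[x i, x i.+1] & v = Lmap N x i u].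
Proof.
move=> N1 /(piece_of_point N1)[i hi vi].
have I0 := ilen_gt0 N1; have h0 := knot_step_gt0 hi.
exists i, (x 1%N + ilen N x * ((v - x i) / knot_step x i)); split=> //.
  move: vi; rewrite !in_itv /= => /andP[v1 v2].
  rewrite lerDl mulr_ge0 ?(ltW I0) ?divr_ge0 ?(ltW h0) ?subr_ge0 //=.
  rewrite -lerBrDl -[leRHS]mulr1 ler_pM2l // ler_pdivrMr // mul1r.
  exact: lerB.
rewrite /Lmap /theta; move: I0 h0; rewrite /ilen => I0 h0.
by field; rewrite !gt_eqF.
Qed.

End Knots.

Lemma continuous_norm_attained (R : realType) (a b : R) (f : R -> R) :
  a <= b -> {within `[a, b], continuous f} ->
  exists2 c, c \in `[a, b] & forall u, u \in `[a, b] -> `|f u| <= `|f c|.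
Proof.
move=> ab cf; apply: (@EVT_max _ (fun u => `|f u|)) => //.
apply: (@within_continuous_comp _ _ _ _ f Num.norm) => // z _.
exact: norm_continuous.
Qed.

Theorem theorem5p1 (R : realType) (N : nat)
    (x y d alpha r t : nat -> R) (p f : R -> R)
    (hN : (2 < N)%N)
    (hx : forall i : nat, (1 <= i < N)%N -> x i < x i.+1)
    (hp : piecewise_linear N x p)
    (hyp : forall i : nat, (1 <= i <= N)%N -> p (x i) <= y i)
    (hr : forall i : nat, (1 <= i < N)%N -> 0 < r i)
    (ht : forall i : nat, (1 <= i < N)%N -> 0 < t i)
    (hf : is_rational_cubic_fif N x y d alpha r t f)
    (h1a : forall i : nat, (1 <= i < N)%N -> `|alpha i| < step_ratio N x i)
    (h1b : fam_norm N.-1 alpha <=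
      fam_min N (fun i =>
        (y i - p (x i)) / (y i - p (x i) + Mconst N x y d)))
    (h2 : forall i : nat, (1 <= i < N)%N ->
      0 <= r i * (2 * y i - p (x i.+1) - p (x i) + knot_step x i * d i
                  + 2 * Kconst N x y d alpha)
           + t i * (y i - p (x i) + Kconst N x y d alpha))
    (h3 : forall i : nat, (1 <= i < N)%N ->
      0 <= r i * (y i.+1 - p (x i.+1) + Kconst N x y d alpha)
           + t i * (2 * y i.+1 - p (x i.+1) - p (x i)
                    - knot_step x i * d i.+1 + 2 * Kconst N x y d alpha)) :
  forall u : R, u \in `[x 1%N, x N] -> p u <= f u.
Proof.
have N1 : (1 < N)%N by lia.
have [cf fE] := hf.
set a := fam_norm N.-1 alpha in h1b *.
set M := Mconst N x y d in h1b *.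
set K := Kconst N x y d alpha in h2 h3 *.
have a1 : a < 1.
  apply: fam_max_lt => [|i hi]; first by lia.
  by apply: (lt_le_trans (h1a _ _)); [lia | apply: step_ratio_le1 => //; lia].
have ha i : (1 <= i < N)%N -> `|alpha i| <= a.
  by move=> hi; apply: fam_norm_ge; lia.
have a0 : 0 <= a by apply: le_trans (normr_ge0 _) (ha 1%N _); lia.
have yle i : (1 <= i <= N)%N -> `|y i| <= fam_norm N y by exact: fam_norm_ge.
have dle i : (1 <= i <= N)%N -> `|d i| <= fam_norm N d by exact: fam_norm_ge.
have hle i : (1 <= i < N)%N -> knot_step x i <= mesh N x.
  by move=> hi; apply: fam_max_ge; lia.
have I0 := ilen_gt0 hx N1.
(* [M] splits into a bound [MC] for the cubics [C] of the pieces and a bound [MB] for the cubics [B]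
   of the whole interval. *)
pose MC := fam_norm N y + 1 / 4 * (mesh N x * fam_norm N d).
pose MB := Num.max `|y 1%N| `|y N|
           + 1 / 4 * (ilen N x * Num.max `|d 1%N| `|d N|).
have ME : M = MC + MB by rewrite /M /Mconst /MC /MB; ring.
pose C i u := rcubic_num (r i) (t i) (y i) (y i.+1) (knot_step x i * d i)
  (knot_step x i * d i.+1) (theta N x u) / rcubic_den (r i) (t i) (theta N x u).
pose B i u := rcubic_num (r i) (t i) (y 1%N) (y N) (ilen N x * d 1%N)
  (ilen N x * d N) (theta N x u) / rcubic_den (r i) (t i) (theta N x u).
have fCB i u : (1 <= i < N)%N -> u \in `[x 1%N, x N] ->
    f (Lmap N x i u) = C i u + alpha i * (f u - B i u).
  move=> hi hu; rewrite (fE i u hi hu) PnumE -/(rcubic_den _ _ _) /C /B.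
  by rewrite /Qden -/(rcubic_den _ _ _); ring.
have CM i u : (1 <= i < N)%N -> u \in `[x 1%N, x N] -> `|C i u| <= MC.
  move=> hi hu; have h0 := ltW (knot_step_gt0 hx hi).
  apply: norm_rcubic_le; rewrite ?hr ?ht ?(theta_itv hu) //;
    try (by apply: yle; lia);
    by rewrite normrM ler_pM ?(ger0_norm h0) ?hle //; apply: dle; lia.
have BM i u : (1 <= i < N)%N -> u \in `[x 1%N, x N] -> `|B i u| <= MB.
  move=> hi hu.
  by apply: norm_rcubic_le; rewrite ?hr ?ht ?(theta_itv hu) //
    ?normrM ?(gtr0_norm I0) ?ler_pM2l // le_max lexx ?orbT.
have x1N : x 1%N <= x N by move: I0; rewrite subr_gt0 => /ltW.
have x1I : x 1%N \in `[x 1%N, x N] by rewrite in_itv /= lexx.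
have MC0 : 0 <= MC by apply: le_trans (normr_ge0 _) (CM 1%N _ _ x1I); lia.
have MB0 : 0 <= MB by apply: le_trans (normr_ge0 _) (BM 1%N _ _ x1I); lia.
have M0 : 0 <= M by rewrite ME addr_ge0.
have KE : - K = a * (M / (1 - a)).
  rewrite /K /Kconst -/a -/M; field.
  by rewrite !subr_eq0 (gt_eqF a1) (lt_eqF a1).
have fB i u : (1 <= i < N)%N -> u \in `[x 1%N, x N] ->
    `|alpha i * (f u - B i u)| <= - K.
  move=> hi hu.
  have [c hc cmax] := continuous_norm_attained x1N cf.
  have [j [w [hj hw _ cE]]] := Lmap_onto hx N1 hc.
  have fc : `|f c| <= MC + a * (`|f c| + MB).
    rewrite {1}cE fCB //; apply: le_trans (ler_normD _ _) _.
    apply: lerD; first exact: CM.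
    rewrite normrM; apply: ler_pM; rewrite ?ha //.
    by apply: le_trans (ler_normB _ _) _; rewrite lerD ?cmax ?BM.
  (* By [fc], (1 - a) |f c| <= MC + a MB; adding (1 - a) MB to both sides leaves MC + MB = M on the
     right. *)
  have fM : `|f c| + MB <= M / (1 - a).
    by rewrite ler_pdivlMr ?subr_gt0 // ME; lra.
  rewrite KE normrM; apply: ler_pM; rewrite ?ha //.
  by apply: le_trans (ler_normB _ _) (le_trans _ fM); rewrite lerD ?cmax ?BM.
have yK i : (1 <= i <= N)%N -> 0 <= y i - p (x i) + K.
  move=> hi; have e0 : 0 <= y i - p (x i) by rewrite subr_ge0 hyp.
  have := le_trans h1b (fam_min_le _ hi); move: e0.
  set e := y i - p (x i) => e0 ae.
  have aeM : a * (e + M) <= e.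
    (* If the denominator in (i) is not positive, then [e] and [M], both nonnegative, vanish, and
       the claim is 0 <= 0. *)
    have [eM0|eM0] := ltP 0 (e + M); first by rewrite -ler_pdivlMr.
    by rewrite (_ : e + M = 0) ?mulr0 //; lra.
  have -> : e + K = (e - a * (e + M)) / (1 - a).
    by rewrite -[K]opprK KE; field; rewrite subr_eq0 gt_eqF.
  by rewrite divr_ge0 ?subr_ge0 // ltW.
move=> v /(Lmap_onto hx N1)[i [u [hi hu vi vE]]].
(* The line [p] on the piece and the cubics in [u] thus share one parameter, as [rcubic_ge_line]
   requires. *)
have phiE : (v - x i) / knot_step x i = theta N x u.
  by rewrite vE /Lmap; field; rewrite gt_eqF // (knot_step_gt0 hx).
rewrite (hp i v hi vi) phiE vE fCB //.
apply: (@le_trans _ _ (C i u + K)).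
  apply: rcubic_ge_line; [exact: hr | exact: ht | exact: theta_itv
    | by apply: yK; lia | by apply: yK; lia | exact: h2 | exact: h3].
by rewrite lerD2l -[K]opprK lerNnormlW ?fB.
Qed.
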